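(* Let $\omega,c,\Lambda,R>0$. Then there exists $L>0$, depending only on $\omega$, $c$, $\Lambda$ and $R$, such that the following holds. If $K$ satisfies $$K(r)\le\Lambda\,\chi_{(-R,R)}(r)\qquad\text{for all }r\in\mathbb{R},$$ and $$u(x,t)=v(x+\omega t)+\Theta,$$ for some $v:\mathbb{R}\to\mathbb{R}$ with $v(0)=0$ and $v'(0)=\kappa\in(0,+\infty)$, is a solution of $$\partial_t u(x,t)=c\,\partial_x^2u(x,t)+\int_{\mathbb{R}}\big(u(y,t)-\Theta\big)_+\,K(x-y)\,dy,\qquad x\in\mathbb{R},\ t\in\mathbb{R},$$ then $v'(x)>0$ for all $x\in(-\infty,L]$. Furthermore, when $c=1$, $\omega=1$ and $\Lambda\left(e^R(e^R-1)-R\right)<1$, one can take $$L:=\ln\left(\frac{1+\Lambda(e^R+R-1)}{\Lambda(e^R-e^{-R})}\right).$$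
   Context: Here $\Theta\in\mathbb{R}$, $r_+:=\max\{r,0\}$, $\chi_A$ is the characteristic function of the set $A$, and $K:\mathbb{R}\to[0,+\infty)$ is a nonnegative measurable function. Solutions are classical: $u$ is continuously differentiable in $t$ and twice continuously differentiable in $x$, so that $v\in C^2(\mathbb{R})$, and the equation holds pointwise. *)

(* Defs.v *)
From HB Require Import structures.
From mathcomp Require Import all_boot all_order all_algebra.
From mathcomp Require Import all_classical all_reals all_analysis.
Set Implicit Arguments.
Unset Strict Implicit.
Unset Printing Implicit Defensive.
Import Order.TTheory GRing.Theory Num.Theory.
Import numFieldNormedType.Exports.
Local Open Scope ring_scope.
Local Open Scope classical_set_scope.

(* A copy of R carrying the Lebesgue sigma-algebra, the domain of
   completed_lebesgue_measure; R itself carries the Borel sigma-algebra. *)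
Definition lebesgueR (R : realType) :=
  caratheodory_type (@wlength R idfun)^*%mu.

Definition lebesgue_measurable_fun (R : realType) (f : R -> R) : Prop :=
  measurable_fun [set: lebesgueR R] (f : lebesgueR R -> R).

Definition C1 (R : realType) (f : R -> R) : Prop :=
  (forall x, derivable f x 1) /\ continuous (derive1 f).

Definition C2 (R : realType) (f : R -> R) : Prop :=
  (forall x, derivable f x 1) /\ C1 (derive1 f).

Definition partial_t (R : realType) (u : R -> R -> R) (x t : R) : R :=
  derive1 (fun s => u x s) t.

Definition partial_xx (R : realType) (u : R -> R -> R) (x t : R) : R :=
  derive1 (derive1 (fun z => u z t)) x.

(* The identity is between extended reals, so it includes the finiteness of
   the integral, whose integrand is nonnegative whenever K is. *)
Definition classical_solution (R : realType) (c Theta : R) (K : R -> R)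
    (u : R -> R -> R) : Prop :=
  [/\ forall x, C1 (fun t => u x t),
      forall t, C2 (fun x => u x t) &
      forall x t,
        ((partial_t u x t)%:E = (c * partial_xx u x t)%:E +
          \int[@completed_lebesgue_measure R]_(y in [set: lebesgueR R])
             (Num.max (u y t - Theta) 0 * K (x - y))%:E)%E].

(* rho is the radius of the kernel bound.  L is fixed before Theta, K, u, v and
   kappa, so it depends on omega, c, Lambda and rho only. *)
Definition waves_increasing_upto (R : realType) (omega c Lambda rho L : R) : Prop :=
  forall (Theta : R) (K : R -> R) (u : R -> R -> R) (v : R -> R) (kappa : R),
    lebesgue_measurable_fun K ->
    (forall r, 0 <= K r) ->
    (forall r, K r <= Lambda * \1_(`]- rho, rho[) r) ->
    (forall x t, u x t = v (x + omega * t) + Theta) ->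
    v 0 = 0 -> derive1 v 0 = kappa -> 0 < kappa ->
    classical_solution c Theta K u ->
    forall x, x <= L -> 0 < derive1 v x.

(* Main.v *)
Require Import Defs.
From mathcomp Require Import all_boot all_order all_algebra.
From mathcomp Require Import all_classical all_reals all_analysis.
From mathcomp Require Import measurable_realfun ring lra.
Import Order.TTheory GRing.Theory Num.Theory.
Import numFieldNormedType.Exports.
Local Open Scope ring_scope.
Set Implicit Arguments.
Unset Strict Implicit.

(** The wave equation for [u(x,t) = v(x + omega t) + Theta] is the ordinary
integro-differential equation [c v'' = omega v' - F] with
[F(x) = \int max(v y, 0) K(x - y) dy >= 0].  Put [a = omega / c],
[kappa = v'(0)] and [h(x) = exp(- a x) v'(x)].  Then
[h' = - exp(- a x) F / c <= 0], so [h] is nonincreasing, and [v'] has the sign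
of [h]: to get [v' > 0] on the whole half-line up to [L] it suffices that
[h(L) > 0] ([waves_increasing_of_drop]).  In other words the total drop
[h(0) - h(L)] must stay below [h(0) = kappa].

The monotonicity of [h] also controls the source [F].  To the left of [0] it
gives [v' >= 0], hence [v <= 0] and nothing is produced there
([profile_le0]); to the right it gives [v' <= kappa exp(a x)], hence
[v <= (kappa / a) exp(a x)] ([profile_le_expR]).  So for [x >= 0] only the
[y] in [[max(0, x - rho), x + rho]] contribute, and
[F(x) <= (Lambda kappa / a^2) (exp(a(x + rho)) - exp(a max(0, x - rho)))]
([profile_source_le]).  Everything is proportional to [kappa], which is why
[L] does not depend on it.

For arbitrary [omega] and [c], the second exponential is discarded: the drop of
[h] on [[0, L]] is then at most [kappa M L] with
[M = Lambda exp(a rho) / (c a^2)], and [L = 1 / (2 M)] will do.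

For [omega = c = 1] the condition on [Lambda] and [rho] says precisely that
[rho < L].  On [[0, rho]] the rate of drop of [h / kappa] is at most
[Lambda (exp(x + rho) - 1)], on [[rho, L]] it is at most
[Lambda (exp rho - exp(- rho))].  The first contributes
[Lambda (exp(2 rho) - exp rho - rho)], the second
[Lambda (exp rho - exp(- rho)) (L - rho)].  Since
[L - rho < exp L - exp rho], their sum is less than
[Lambda ((exp rho - exp(- rho)) exp L - (exp rho + rho - 1))], and [L] is the
point where this last expression equals [1]. *)

(** * Comparison of increments *)

Lemma is_derive_derive1 (R : realType) (f : R -> R) (x : R) :
  derivable f x 1 -> is_derive x 1 f (derive1 f x).
Proof. by move=> df; split => //; rewrite derive1E. Qed.

Lemma is_derive_mull (R : realType) (k x : R) :
  is_derive x 1 (fun y => k * y) k.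
Proof.
apply: (@is_derive_eq _ _ _ (k \*: id)).
by rewrite scaler1.
Qed.

Lemma is_derive_expRM (R : realType) (a x : R) :
  is_derive x 1 (fun y => expR (a * y)) (a * expR (a * x)).
Proof.
rewrite mulrC.
exact: (is_derive1_comp (is_derive_expR (a * x)) (is_derive_mull a x)).
Qed.

Lemma is_derive_expRM_primitive (R : realType) (a C x : R) : a != 0 ->
  is_derive x 1 (fun y => C / a * expR (a * y)) (C * expR (a * x)).
Proof.
move=> a0; have := is_deriveZ (C / a) (is_derive_expRM a x).
by rewrite /GRing.scale /= mulrA divfK.
Qed.

(** The mean value theorem for [g - f]. *)
Lemma le_increment (R : realType) (f g df dg : R -> R) (x y : R) :
  (forall z : R, is_derive z 1 f (df z)) ->
  (forall z : R, is_derive z 1 g (dg z)) ->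
  x <= y -> (forall z, x < z < y -> df z <= dg z) ->
  f y - f x <= g y - g x.
Proof.
move=> df_f dg_g; rewrite le_eqVlt => /predU1P[<-|xy] dfg.
  by rewrite !subrr.
have dh (z : R) : is_derive z 1 (g - f) (dg z - df z) by exact: is_deriveB.
have [|z zxy] :=
    @MVT R (g - f) (fun z => dg z - df z) x y xy (fun z _ => dh z).
  by apply: derivable_within_continuous => z _; case: (dh z).
rewrite in_itv/= in zxy; have := dfg z zxy.
rewrite !fctE => dfgz gfE.
have : 0 <= (dg z - df z) * (y - x) by rewrite mulr_ge0 ?subr_ge0// ltW.
lra.
Qed.

(** * Integration against the completed Lebesgue measure *)

(** The integral of a nonnegative function is a supremum over the simple
functions below it, so monotonicity holds for arbitrary, possibly
nonmeasurable, functions. *)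
Lemma ge0_le_integral_any d (T : measurableType d) (R : realType)
    (mu : {measure set T -> \bar R}) (f g : T -> \bar R) :
  (forall x, 0 <= f x)%E -> (forall x, f x <= g x)%E ->
  (\int[mu]_x f x <= \int[mu]_x g x)%E.
Proof.
move=> f0 fg.
have g0 x : (0 <= g x)%E by exact: le_trans (f0 x) (fg x).
rewrite !ge0_integralTE //; apply: ereal_sup_le => _ [h hf <-].
by exists h => // x; apply: le_trans (hf x) (fg x).
Qed.

(** The Lebesgue measure is the image of its completion under the identity,
which is measurable from the Lebesgue to the Borel sigma-algebra. *)
Lemma ge0_integral_completed_lebesgue (R : realType) (f : R -> R) :
  measurable_fun [set: R] f -> (forall x, 0 <= f x) ->
  (\int[@completed_lebesgue_measure R]_(y in [set: lebesgueR R]) (f y)%:E =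
   \int[@lebesgue_measure R]_y (f y)%:E)%E.
Proof.
move=> mf f0; pose idR : lebesgueR R -> measurableTypeR R := idfun.
have midR : measurable_fun [set: lebesgueR R] idR.
  by move=> _ B mB; rewrite setTI preimage_id; exact: sub_caratheodory.
transitivity
    (\int[pushforward (@completed_lebesgue_measure R) idR]_y (f y)%:E)%E.
  rewrite (ge0_integral_pushforward midR) ?preimage_setT//.
    by apply/measurable_EFinP.
  by move=> y _; rewrite lee_fin.
exact: eq_measure_integral.
Qed.

Lemma integral_expRM (R : realType) (a C lo hi : R) : a != 0 -> lo < hi ->
  (\int[@lebesgue_measure R]_(y in `[lo, hi]%classic) (C * expR (a * y))%:E =
   (C / a * (expR (a * hi) - expR (a * lo)))%:E)%E.
Proof.
move=> a0 lohi.
have dF (x : R) := is_derive_expRM_primitive C x a0.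
have cF (x : R) : {for x, continuous (fun y => C / a * expR (a * y))}.
  by apply/differentiable_continuous/derivable1_diffP; case: (dF x).
rewrite (continuous_FTC2 (F := fun y => C / a * expR (a * y)) lohi).
- by rewrite mulrBr EFinB.
- apply: derivable_within_continuous => z _.
  by apply: derivableM => //; case: (is_derive_expRM a z).
- split.
  + by move=> z _; case: (dF z).
  + exact/cvg_at_right_filter/cF.
  + exact/cvg_at_left_filter/cF.
- by move=> z _; rewrite derive1E; case: (dF z).
Qed.

Lemma integral_le_expRM (R : realType) (f : R -> R) (a C lo hi : R) :
  a != 0 -> 0 <= C -> lo < hi -> (forall y, 0 <= f y) ->
  (forall y, y \in `[lo, hi] -> f y <= C * expR (a * y)) ->
  (forall y, y \notin `[lo, hi] -> f y = 0) ->
  (\int[@completed_lebesgue_measure R]_(y in [set: lebesgueR R]) (f y)%:E <=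
   (C / a * (expR (a * hi) - expR (a * lo)))%:E)%E.
Proof.
move=> a0 C0 lohi f0 fin fout.
pose g := (fun y : R => C * expR (a * y)) \_ `[lo, hi]%classic.
have gE y : g y = if y \in `[lo, hi] then C * expR (a * y) else 0.
  by rewrite /g /patch mem_setE.
have mg : measurable_fun [set: R] g.
  apply/(measurable_restrictT _ _).1 => //.
  apply: measurable_funTS; apply: measurable_funM => //.
  apply: (measurableT_comp (@measurable_expR R)).
  exact: mulrl_measurable.
have g0 y : 0 <= g y.
  by rewrite gE; case: ifP => // _; rewrite mulr_ge0 ?expR_ge0.
have fg y : f y <= g y by rewrite gE; case: ifPn => [/fin//|/fout ->].
apply: (@le_trans _ _ (\int[@completed_lebesgue_measure R]_(y in
    [set: lebesgueR R]) (g y)%:E)%E).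
  by apply: ge0_le_integral_any => y; rewrite lee_fin.
rewrite ge0_integral_completed_lebesgue // -(integral_expRM C a0 lohi).
by rewrite [leRHS]integral_mkcond restrict_EFin.
Qed.

(** * Profiles of travelling waves *)

Record wave_profile (R : realType) (omega c Lambda rho : R) (K v : R -> R) :
    Prop := WaveProfile {
  kernel_ge0 : forall r, 0 <= K r;
  kernel_le : forall r, K r <= Lambda * \1_(`]- rho, rho[%classic) r;
  profile_derivable : forall x, derivable v x 1;
  profile_derivable2 : forall x, derivable (derive1 v) x 1;
  profile_sourceE : forall x,
    (\int[@completed_lebesgue_measure R]_(y in [set: lebesgueR R])
       (Num.max (v y) 0 * K (x - y))%:E =
     (omega * derive1 v x - c * derive1 (derive1 v) x)%:E)%E;
  profile0 : v 0 = 0;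
  profile_slope0_gt0 : 0 < derive1 v 0 }.

(** The equation of the profile is that of [u] at time [0]. *)
Lemma wave_profile_of_solution (R : realType) (omega c Lambda rho Theta : R)
    (K : R -> R) (u : R -> R -> R) (v : R -> R) :
  (forall r, 0 <= K r) ->
  (forall r, K r <= Lambda * \1_(`]- rho, rho[%classic) r) ->
  (forall x t, u x t = v (x + omega * t) + Theta) ->
  v 0 = 0 -> 0 < derive1 v 0 -> classical_solution c Theta K u ->
  wave_profile omega c Lambda rho K v.
Proof.
move=> K0 KL uE v0 k0 [_ u_xx ueq].
have u0E : (fun z => u z 0) = v + cst Theta.
  by apply/funext => z; rewrite uE mulr0 addr0.
have vE : v = (fun z => u z 0) + cst (- Theta).
  by apply/funext => z; rewrite u0E !fctE addrK.
have [du [d2u _]] := u_xx 0.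
have dv (x : R) : derivable v x 1.
  by rewrite vE; apply: derivableD => //; exact: du.
have u0'E : derive1 (fun z => u z 0) = derive1 v.
  by apply/funext => z; rewrite u0E !derive1E deriveD// derive_cst ?addr0.
have d2v (x : R) : derivable (derive1 v) x 1 by rewrite -u0'E; exact: d2u.
apply: (WaveProfile K0 KL dv d2v _ v0 k0) => x.
have utE : partial_t u x 0 = omega * derive1 v x.
  rewrite /partial_t.
  have -> : (fun s => u x s) = (v \o (fun s => x + omega * s)) + cst Theta.
    by apply/funext => s; rewrite uE.
  have dl : is_derive (0 : R) 1 (fun s => x + omega * s) omega.
    have := is_deriveD (is_derive_cst (x : R) (0 : R) (1 : R))
      (is_deriveZ omega (is_derive_id (0 : R) (1 : R))).
    by rewrite add0r /GRing.scale/= mulr1.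
  have dvx : is_derive (x + omega * 0) 1 v (derive1 v x).
    by rewrite mulr0 addr0; exact/is_derive_derive1/dv.
  have [dc dcE] := @is_derive1_comp R v (fun s => x + omega * s) 0 _ _ dvx dl.
  by rewrite derive1E deriveD// derive_cst addr0 dcE mulrC.
have := ueq x 0; rewrite utE /partial_xx u0'E.
under eq_integral do rewrite uE mulr0 addr0 addrK.
by move: (integral _ _ _) => [r| |] //= [] ->; congr (_%:E); ring.
Qed.

(** * The damped slope *)

(** With [a = omega / c], the factor [expR (- a * x)] integrates the linear
part [c v'' = omega v'] of the equation. *)
Definition damped_slope (R : realType) (a : R) (v : R -> R) (x : R) : R :=
  expR (- a * x) * derive1 v x.

Lemma damped_slope0 (R : realType) (a : R) (v : R -> R) :
  damped_slope a v 0 = derive1 v 0.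
Proof. by rewrite /damped_slope mulr0 expR0 mul1r. Qed.

Lemma derive1_damped_slope (R : realType) (a : R) (v : R -> R) (x : R) :
  derive1 v x = damped_slope a v x * expR (a * x).
Proof. by rewrite /damped_slope mulrAC -expRD mulNr addNr expR0 mul1r. Qed.

Lemma is_derive_damped_slope (R : realType) (omega c Lambda rho : R)
    (K v : R -> R) (x : R) :
  0 < c -> wave_profile omega c Lambda rho K v ->
  is_derive x 1 (damped_slope (omega / c) v)
    (- (expR (- (omega / c) * x) / c
        * (omega * derive1 v x - c * derive1 (derive1 v) x))).
Proof.
move=> c0 vP.
have dw : is_derive x 1 (derive1 v) (derive1 (derive1 v) x).
  exact/is_derive_derive1/(profile_derivable2 vP).
apply: is_derive_eq (is_deriveM (is_derive_expRM (- (omega / c)) x) dw) _.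
rewrite /GRing.scale /=.
by field; rewrite gt_eqF.
Qed.

Lemma profile_source_ge0 (R : realType) (omega c Lambda rho : R)
    (K v : R -> R) (x : R) :
  wave_profile omega c Lambda rho K v ->
  0 <= omega * derive1 v x - c * derive1 (derive1 v) x.
Proof.
move=> vP; rewrite -lee_fin -(profile_sourceE vP); apply: integral_ge0 => y _.
by rewrite lee_fin mulr_ge0 ?(kernel_ge0 vP)// le_max lexx orbT.
Qed.

Lemma damped_slope_nonincreasing (R : realType) (omega c Lambda rho : R)
    (K v : R -> R) (x y : R) :
  0 < c -> wave_profile omega c Lambda rho K v -> x <= y ->
  damped_slope (omega / c) v y <= damped_slope (omega / c) v x.
Proof.
move=> c0 vP xy; rewrite -subr_le0 -[leRHS](subrr (0 : R)).
apply: (le_increment (g := cst 0) (dg := cst 0)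
  (fun z => is_derive_damped_slope z c0 vP)) => // z _.
rewrite /= oppr_le0 mulr_ge0 ?(profile_source_ge0 _ vP)//.
by rewrite divr_ge0 ?expR_ge0 ?ltW.
Qed.

(** * Bounds on the profile and on the source *)

(** On the left half-line the damped slope is at least its value at [0], so
the profile increases there up to [v 0 = 0]. *)
Lemma profile_le0 (R : realType) (omega c Lambda rho : R)
    (K v : R -> R) (x : R) :
  0 < c -> wave_profile omega c Lambda rho K v -> x <= 0 -> v x <= 0.
Proof.
move=> c0 vP x0.
suff : (0 : R) - 0 <= v 0 - v x by rewrite (profile0 vP); lra.
apply: (le_increment (f := cst 0) (g := v) (df := cst 0) (dg := derive1 v))
  => // [z|z /andP[_ z0]].
  exact/is_derive_derive1/(profile_derivable vP).
rewrite (derive1_damped_slope (omega / c)) mulr_ge0 ?expR_ge0//.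
rewrite (le_trans (ltW (profile_slope0_gt0 vP)))//.
rewrite -(damped_slope0 (omega / c)).
exact: (damped_slope_nonincreasing c0 vP (ltW z0)).
Qed.

(** On the right half-line the damped slope is at most its value at [0], which
is integrated from [0] to [x]; the negative constant of integration is
dropped. *)
Lemma profile_le_expR (R : realType) (omega c Lambda rho : R)
    (K v : R -> R) (x : R) :
  0 < omega -> 0 < c -> wave_profile omega c Lambda rho K v -> 0 <= x ->
  v x <= derive1 v 0 / (omega / c) * expR (omega / c * x).
Proof.
move=> omega0 c0 vP x0.
set a := omega / c; have a0 : 0 < a by rewrite divr_gt0.
set k := derive1 v 0.
have : v x - v 0 <= k / a * expR (a * x) - k / a * expR (a * 0).
  apply: (le_increment (f := v) (g := fun z => k / a * expR (a * z))
    (df := derive1 v) (dg := fun z => k * expR (a * z)))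
    => // [z|z|z /andP[z0 _]].
  - exact/is_derive_derive1/(profile_derivable vP).
  - by apply: is_derive_expRM_primitive; rewrite gt_eqF.
  - rewrite (derive1_damped_slope a) ler_wpM2r ?expR_ge0//.
    rewrite /k -(damped_slope0 a).
    exact: (damped_slope_nonincreasing c0 vP (ltW z0)).
rewrite (profile0 vP) subr0 mulr0 expR0 mulr1 => /le_trans; apply.
by rewrite gerBl divr_ge0 ?ltW// (profile_slope0_gt0 vP).
Qed.

(** Points [y < 0] do not contribute because [v y <= 0], points at distance at
least [rho] from [x] because the kernel vanishes; elsewhere the integrand is at
most [Lambda (kappa / a) exp(a y)]. *)
Lemma profile_source_le (R : realType) (omega c Lambda rho : R)
    (K v : R -> R) (x : R) :
  0 < omega -> 0 < c -> 0 < Lambda -> 0 < rho ->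
  wave_profile omega c Lambda rho K v -> 0 <= x ->
  omega * derive1 v x - c * derive1 (derive1 v) x <=
  derive1 v 0 * Lambda / (omega / c) ^+ 2 *
    (expR (omega / c * (x + rho)) - expR (omega / c * Num.max 0 (x - rho))).
Proof.
move=> omega0 c0 Lam0 rho0 vP x0.
have k0 := ltW (profile_slope0_gt0 vP).
have K0 := kernel_ge0 vP.
set a := omega / c.
have a0 : 0 < a by rewrite divr_gt0.
have Kout r : ~~ (- rho < r < rho) -> K r = 0.
  move=> rout; apply/eqP; rewrite eq_le K0 andbT (le_trans (kernel_le vP r))//.
  by rewrite indicE mem_setE in_itv/= (negbTE rout) mulr0.
have Kle r : K r <= Lambda.
  rewrite (le_trans (kernel_le vP r))// indicE.
  by case: (_ \in _); rewrite ?mulr1// mulr0 ltW.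
rewrite -lee_fin -(profile_sourceE vP).
have -> : derive1 v 0 * Lambda / a ^+ 2 = (derive1 v 0 / a * Lambda) / a.
  by field; rewrite gt_eqF.
apply: integral_le_expRM => //.
- by rewrite gt_eqF.
- by rewrite mulr_ge0 ?divr_ge0// ltW.
- by rewrite gt_max; apply/andP; split; lra.
- by move=> y; rewrite mulr_ge0// le_max lexx orbT.
- move=> y; rewrite in_itv/= ge_max => /andP[/andP[y0 _] _].
  rewrite mulrAC ler_pM ?le_max ?lexx ?orbT// ge_max.
  rewrite (profile_le_expR omega0 c0 vP y0)/=.
  by rewrite mulr_ge0 ?expR_ge0// divr_ge0// ltW.
- move=> y; rewrite in_itv/= ge_max => yout.
  have [y0|y0] := leP y 0.
    by have /max_idPr -> := profile_le0 c0 vP y0; rewrite mul0r.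
  rewrite Kout ?mulr0//; apply: contra yout => /andP[y1 y2].
  by rewrite (ltW y0) /=; apply/andP; split; lra.
Qed.

(** * The drop of the damped slope *)

(** Upper bound for [- h' / kappa], where [h] is the damped slope and [kappa]
its value at [0]. *)
Definition drop_rate (R : realType) (omega c Lambda rho x : R) : R :=
  Lambda / (c * (omega / c) ^+ 2) * (expR (- (omega / c) * x) *
    (expR (omega / c * (x + rho)) - expR (omega / c * Num.max 0 (x - rho)))).

Lemma damped_slope_drop_le (R : realType) (omega c Lambda rho : R)
    (K v G dG : R -> R) (x y : R) :
  0 < omega -> 0 < c -> 0 < Lambda -> 0 < rho ->
  wave_profile omega c Lambda rho K v ->
  (forall z : R, is_derive z 1 G (dG z)) ->
  0 <= x -> x <= y ->
  (forall z, x < z < y -> drop_rate omega c Lambda rho z <= dG z) ->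
  damped_slope (omega / c) v x - damped_slope (omega / c) v y <=
  derive1 v 0 * (G y - G x).
Proof.
move=> omega0 c0 Lam0 rho0 vP GdG x0 xy dG_ge.
set h := damped_slope _ v; set k := derive1 v 0.
have kG (z : R) : is_derive z 1 (fun z => - k * G z) (- k * dG z).
  exact: is_deriveZ.
suff : - k * G y - - k * G x <= h y - h x by lra.
apply: (le_increment kG (fun z => is_derive_damped_slope z c0 vP)) => // z zxy.
have /andP[xz _] := zxy.
rewrite mulNr lerN2.
apply: (le_trans _ (ler_wpM2l (ltW (profile_slope0_gt0 vP)) (dG_ge z zxy))).
have ec0 : 0 <= expR (- (omega / c) * z) / c.
  by rewrite divr_ge0 ?expR_ge0 ?ltW.
have z0 : 0 <= z by rewrite (le_trans x0)// ltW.
apply: (le_trans (ler_wpM2l ec0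
  (profile_source_le omega0 c0 Lam0 rho0 vP z0))).
rewrite /drop_rate le_eqVlt; apply/orP; left; apply/eqP.
by field; rewrite !gt_eqF.
Qed.

(** Since the damped slope is nonincreasing, it is positive up to [L] as soon
as it is positive at [L]. *)
Lemma waves_increasing_of_drop (R : realType) (omega c Lambda rho L D : R) :
  0 < c -> D < 1 ->
  (forall K v, wave_profile omega c Lambda rho K v ->
     damped_slope (omega / c) v 0 - damped_slope (omega / c) v L <=
     derive1 v 0 * D) ->
  waves_increasing_upto omega c Lambda rho L.
Proof.
move=> c0 D1 drop Theta K u v k _ K0 KL uE v0 kE k0 usol x xL.
have vP : wave_profile omega c Lambda rho K v.
  by apply: wave_profile_of_solution uE v0 _ usol => //; rewrite kE.
rewrite (derive1_damped_slope (omega / c)) mulr_gt0 ?expR_gt0//.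
apply: (lt_le_trans _ (damped_slope_nonincreasing c0 vP xL)).
have := drop _ _ vP; rewrite damped_slope0 kE.
have : k * D < k * 1 by rewrite ltr_pM2l.
lra.
Qed.

(** * Admissible values of L *)

(** The drop rate is at most the constant [M]; with [L = 1 / (2 M)] the damped
slope loses at most half of its initial value. *)
Lemma waves_increasing_general (R : realType) (omega c Lambda rho : R) :
  0 < omega -> 0 < c -> 0 < Lambda -> 0 < rho ->
  exists L : R, 0 < L /\ waves_increasing_upto omega c Lambda rho L.
Proof.
move=> omega0 c0 Lam0 rho0.
set a := omega / c; have a0 : 0 < a by rewrite divr_gt0.
pose C := Lambda / (c * a ^+ 2).
have C0 : 0 < C by rewrite divr_gt0// mulr_gt0 ?exprn_gt0.
pose M := C * expR (a * rho).
have M0 : 0 < M by rewrite mulr_gt0 ?expR_gt0.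
pose L := 2^-1 / M.
have L0 : 0 < L by rewrite divr_gt0.
exists L; split=> //.
apply: (@waves_increasing_of_drop _ _ _ _ _ _ (M * L - M * 0)) => //.
  by rewrite mulr0 subr0 mulrC divfK ?gt_eqF//; lra.
move=> K v vP.
apply: (damped_slope_drop_le omega0 c0 Lam0 rho0 vP
  (fun z => is_derive_mull M z) _ (ltW L0)) => // z _.
rewrite /drop_rate -/a -/C /M ler_wpM2l ?(ltW C0)// mulrBr -expRD.
have -> : - a * z + a * (z + rho) = a * rho by ring.
by rewrite gerBl mulr_ge0 ?expR_ge0.
Qed.

(** For [x <= rho] the source is integrated from [max(0, x - rho) = 0]; the
damping factor [expR (- x) <= 1] is discarded. *)
Lemma drop_rate1_le_near (R : realType) (Lambda rho x : R) :
  0 < Lambda -> 0 < x -> x <= rho ->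
  drop_rate 1 1 Lambda rho x <= Lambda * (expR rho * expR x - 1).
Proof.
move=> Lam0 x0 xrho.
rewrite /drop_rate !divr1 expr1n !mul1r !divr1 ler_wpM2l ?(ltW Lam0)//.
have /max_idPl -> : x - rho <= 0 by lra.
rewrite expR0 mulN1r [x + rho]addrC expRD.
have Ex : 1 <= expR x by rewrite -expR0 ler_expR ltW.
have Er : 1 <= expR rho by rewrite -expR0 ler_expR (le_trans (ltW x0)).
have EE : 0 <= expR rho * expR x - 1 by rewrite subr_ge0 mulr_ege1.
by rewrite ler_piMl// expRN invf_le1 ?expR_gt0.
Qed.

Lemma drop_rate1_far (R : realType) (Lambda rho x : R) :
  rho <= x ->
  drop_rate 1 1 Lambda rho x = Lambda * (expR rho - expR (- rho)).
Proof.
move=> rhox; rewrite /drop_rate !divr1 expr1n !mul1r !divr1.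
have /max_idPr -> : 0 <= x - rho by lra.
rewrite mulrBr -!expRD; congr (_ * (expR _ - expR _)); ring.
Qed.

Lemma waves_increasing_unit (R : realType) (Lambda rho : R) :
  0 < Lambda -> 0 < rho ->
  Lambda * (expR rho * (expR rho - 1) - rho) < 1 ->
  let L := ln ((1 + Lambda * (expR rho + rho - 1)) /
                (Lambda * (expR rho - expR (- rho)))) in
  0 < L /\ waves_increasing_upto 1 1 Lambda rho L.
Proof.
move=> Lam0 rho0 cond L.
set E := expR rho; set E' := expR (- rho).
have EE' : E * E' = 1 by rewrite -expRD subrr expR0.
have E1 : 1 < E by rewrite -expR0 ltr_expR.
have S0 : 0 < Lambda * (E - E').
  by rewrite mulr_gt0// subr_gt0 ltr_expR; lra.
have num0 : 0 < 1 + Lambda * (E + rho - 1).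
  by rewrite addr_gt0// mulr_gt0//; lra.
have eL : expR L * (Lambda * (E - E')) = 1 + Lambda * (E + rho - 1).
  by rewrite /L lnK ?divfK ?gt_eqF// posrE divr_gt0.
have condE : E * (Lambda * (E - E')) = Lambda * (E * E) - Lambda.
  by rewrite mulrCA mulrBr EE' mulrBr mulr1.
(* the smallness condition, rewritten as [expR rho < expR L] *)
have rhoL : rho < L.
  rewrite -ltr_expR -/E -(ltr_pM2r S0) eL condE.
  by move: cond; rewrite -/E; lra.
have L0 : 0 < L by exact: lt_trans rhoL.
split=> //.
(* the drops on [0, rho] and on [rho, L], as increments of primitives of the
   bounds on the drop rate *)
pose D := Lambda * (E * E - rho) - Lambda * (E * 1 - 0)
  + (Lambda * (E - E') * L - Lambda * (E - E') * rho).
apply: (@waves_increasing_of_drop _ _ _ _ _ _ D) => // [|K v vP].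
  (* [exp L - exp rho = exp rho (exp (L - rho) - 1) > L - rho] *)
  have gap : L - rho < expR L - E.
    have -> : expR L = E * expR (L - rho) by rewrite -expRD addrC subrK.
    have := expR_ge1Dx (L - rho); have : 0 < L - rho by rewrite subr_gt0.
    move: (expR (L - rho)) => t; nra.
  by have := gap; rewrite -(ltr_pM2l S0) /D; lra.
have dG1 (z : R) : is_derive z 1 (fun z => Lambda * (E * expR z - z))
    (Lambda * (E * expR z - 1)).
  by apply: is_deriveZ; apply: is_deriveB; exact: is_deriveZ.
have h1 : damped_slope (1 / 1) v 0 - damped_slope (1 / 1) v rho <=
    derive1 v 0 * (Lambda * (E * expR rho - rho) - Lambda * (E * expR 0 - 0)).
  apply: (damped_slope_drop_le ltr01 ltr01 Lam0 rho0 vP dG1 _ (ltW rho0)) => //.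
  by move=> z /andP[z0 zrho]; apply: drop_rate1_le_near => //; exact: ltW.
have dG2 (z : R) : is_derive z 1 (fun z => Lambda * (E - E') * z)
    (Lambda * (E - E')).
  exact: is_derive_mull.
have h2 : damped_slope (1 / 1) v rho - damped_slope (1 / 1) v L <=
    derive1 v 0 * (Lambda * (E - E') * L - Lambda * (E - E') * rho).
  apply: (damped_slope_drop_le ltr01 ltr01 Lam0 rho0 vP dG2 (ltW rho0)
    (ltW rhoL)).
  by move=> z /andP[z0 _]; rewrite drop_rate1_far// ltW.
by move: h1; rewrite expR0 /D [leRHS]mulrDr -/E; lra.
Qed.

Unset Implicit Arguments.

Theorem theorem2p13 (R : realType) (omega c Lambda rho : R)
    (omega_gt0 : 0 < omega) (c_gt0 : 0 < c)
    (Lambda_gt0 : 0 < Lambda) (rho_gt0 : 0 < rho) :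
  (exists L : R, 0 < L /\ waves_increasing_upto omega c Lambda rho L) /\
  (c = 1 -> omega = 1 ->
   Lambda * (expR rho * (expR rho - 1) - rho) < 1 ->
   let L := ln ((1 + Lambda * (expR rho + rho - 1)) /
                (Lambda * (expR rho - expR (- rho)))) in
   0 < L /\ waves_increasing_upto omega c Lambda rho L).
Proof.
split; first exact: waves_increasing_general.
by move=> -> -> cond; exact: waves_increasing_unit.
Qed.
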